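(* For $n = 1,\dots,N$, let $Z_{n} := f_{n}(Y_{n,1},\dots,Y_{n,K(n)})$ be a real-valued (measurable) function of independent random variables $Y_{n,k}$, and suppose that $f_{n}$ has finite McDiarmid diameter $\mathcal{D}[f_{n}]$. Let $Z = (Z_{1},\dots,Z_{N})$. Suppose that the random inputs of each $f_{n}$ are sampled independently $M(n) \geq 1$ times, giving independent random variables $Y_{n,k}^{(m)}$ ($1 \leq n \leq N$, $1 \leq k \leq K(n)$, $1 \leq m \leq M(n)$) with each $Y_{n,k}^{(m)}$ distributed as $Y_{n,k}$, and that the empirical average $$\widehat{\mathbb{E}}[Z] := \left(\frac{1}{M(n)}\sum_{m=1}^{M(n)} f_{n}\big(Y_{n,1}^{(m)},\dots,Y_{n,K(n)}^{(m)}\big)\right)_{n=1}^{N} \in \mathbb{R}^{N}$$ is formed. Then, for any (measurable) $A \subseteq \mathbb{R}^{N}$, $$\mathbb{P}\left[\widehat{\mathbb{E}}[Z] \in A\right] \leq \exp\left(-\frac{d_{\perp,\Psi}(\mathbb{E}[Z],A)^{2}}{2}\right),$$ where $\Psi \colon (\mathbb{R}^{N})^{\ast} \to [0,+\infty)$ is given by $$\Psi(\nu) := \frac{1}{2}\left(\sum_{n=1}^{N}\frac{\nu_{n}^{2}\,\mathcal{D}[f_{n}]^{2}}{M(n)}\right)^{1/2}.$$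
   Context: For a real-valued function $f$ of $K$ variables (defined on a product of $K$ sets), the $k$-th McDiarmid subdiameter is $\mathcal{D}_{k}[f] := \sup\{|f(x)-f(y)| : x_{j} = y_{j} \text{ for all } j \neq k\}$, and the McDiarmid diameter is $\mathcal{D}[f] := \left(\sum_{k=1}^{K}\mathcal{D}_{k}[f]^{2}\right)^{1/2}$. For $p \in \mathbb{R}^{N}$ and $\nu \in (\mathbb{R}^{N})^{\ast} \cong \mathbb{R}^{N}$ let $\mathbb{H}_{p,\nu} := \{x \in \mathbb{R}^{N} : \nu\cdot x \leq \nu\cdot p\}$, and let $t_{+} := \max\{t,0\}$. For a function $\Psi \colon (\mathbb{R}^{N})^{\ast} \to [0,+\infty]$ that is positively homogeneous of degree one, the $\Psi$-normal distance from $x \in \mathbb{R}^{N}$ to $A \subseteq \mathbb{R}^{N}$ is $$d_{\perp,\Psi}(x,A) := \sup\left\{\frac{(\nu\cdot(x-p))_{+}}{\Psi(\nu)} : p \in \mathbb{R}^{N},\ \nu \in (\mathbb{R}^{N})^{\ast},\ A \subseteq \mathbb{H}_{p,\nu}\right\},$$ with the conventions $0/0 = 0$ and $c/0 = +\infty$ for $c > 0$; also $\exp(-\infty) = 0$. *)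

(* Defs.v *)
From HB Require Import structures.
From mathcomp Require Import all_boot all_order all_algebra.
From mathcomp Require Import all_classical all_reals all_analysis.

Set Implicit Arguments.
Unset Strict Implicit.
Unset Printing Implicit Defensive.
Import Order.TTheory GRing.Theory Num.Theory.
Import numFieldNormedType.Exports.
Local Open Scope classical_set_scope.
Local Open Scope ring_scope.

Section McDiarmid.
Context {R : realType} {K : nat} {T : 'I_K -> Type}.
Implicit Type f : (forall k, T k) -> R.

Definition mcdiarmid_subdiam f (k : 'I_K) : \bar R :=
  ereal_sup [set z | exists x y : forall k, T k,
    (forall j, j != k -> x j = y j) /\ z = `|f x - f y|%:E].

Definition mcdiarmid_diam f : \bar R :=
  sqrte (\sum_(k < K) mcdiarmid_subdiam f k ^+ 2)%E.

End McDiarmid.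

Section NormalDistance.
Context {R : realType} {N : nat}.
Implicit Types (p x nu : 'rV[R]_N) (A : set 'rV[R]_N).

Definition pairing nu x : R := \sum_(n < N) nu 0 n * x 0 n.

Definition halfspace p nu : set 'rV[R]_N :=
  [set x | pairing nu x <= pairing nu p].

(* The division of [\bar R] satisfies 0 / 0 = 0 * +oo = 0, c / 0 = +oo for
   c > 0, and c / +oo = 0. *)
Definition normal_dist (Psi : 'rV[R]_N -> \bar R) x A : \bar R :=
  ereal_sup [set z | exists p nu, A `<=` halfspace p nu /\
    z = ((Num.max (pairing nu (x - p)) 0)%:E / Psi nu)%E].

End NormalDistance.

Definition borel_set {X : topologicalType} (A : set X) : Prop :=
  <<s [set U : set X | open U] >> A.

(* [forall i, T i] with the product sigma-algebra, i.e. the one generated by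
   the coordinate projections. *)
Definition prod_measurableType (I : Type) (d : I -> measure_display)
    (T : forall i, measurableType (d i)) :=
  g_sigma_algebraType
    (\bigcup_i preimage_set_system [set: forall i, T i] (fun x => x i)
                                   (@measurable _ (T i))).

Definition mutually_independent {d0} {Omega : measurableType d0}
    {R : realType} (P : probability Omega R) {I : finType}
    {d : I -> measure_display} {T : forall i, measurableType (d i)}
    (X : forall i, Omega -> T i) : Prop :=
  forall (J : {set I}) (B : forall i, set (T i)),
    (forall i, measurable (B i)) ->
    P (\bigcap_(i in [set` J]) X i @^-1` B i) =
    (\prod_(i in J) P (X i @^-1` B i))%E.

Section Sampling.
Context {R : realType} {N : nat} {K : 'I_N -> nat}.

Definition mean_vector {d0} {Omega : measurableType d0}
    (P : probability Omega R) (Z : 'I_N -> Omega -> R) : 'rV[R]_N :=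
  \row_n fine ('E_P[Z n]).

Definition empirical_average {T : forall n, 'I_(K n) -> Type} {Omega : Type}
    (M : 'I_N -> nat) (f : forall n, (forall k, T n k) -> R)
    (Y : forall n (k : 'I_(K n)), 'I_(M n) -> Omega -> T n k)
    (w : Omega) : 'rV[R]_N :=
  \row_n ((M n)%:R^-1 * \sum_(m < M n) f n (fun k => Y n k m w)).

Definition sampling_Psi {T : forall n, 'I_(K n) -> Type} (M : 'I_N -> nat)
    (f : forall n, (forall k, T n k) -> R) (nu : 'rV[R]_N) : R :=
  2^-1 * Num.sqrt (\sum_(n < N)
    nu 0 n ^+ 2 * fine (mcdiarmid_diam (f n)) ^+ 2 / (M n)%:R).

End Sampling.

(* Main.v *)
(* Fix a half-space containing [A], with normal [nu]. The event forces the
   linear functional [nu] of the empirical average, a function of all the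
   independent samples, to lie below its mean by at least [nu . (E[Z] - p)].
   Averaging out the samples one at a time, each step costing a factor
   [exp (c ^ 2 / 8)] by Hoeffding's lemma, bounds its moment generating
   function; the squared subdiameters sum to [4 Psi(nu) ^ 2], so Chernoff's
   bound gives the claim for this half-space, and the supremum over
   half-spaces follows since [z |-> exp (- z ^ 2 / 2)] is continuous and
   nonincreasing on [[0, +oo]]. *)
Require Import Defs.
From HB Require Import structures.
From mathcomp Require Import all_boot all_order all_algebra.
From mathcomp Require Import all_classical all_reals all_analysis.
From mathcomp Require Import measurable_realfun ring lra.

Set Implicit Arguments.
Unset Strict Implicit.
Unset Printing Implicit Defensive.
Import Order.TTheory GRing.Theory Num.Theory.
Import numFieldNormedType.Exports.
Local Open Scope classical_set_scope.
Local Open Scope ring_scope.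

(** * Hoeffding's lemma *)

Lemma ge0_of_derive_ge0 (R : realType) (f f' : R -> R) (h : R) :
  (forall x, is_derive x (1 : R) f (f' x)) -> (forall x, 0 <= x -> 0 <= f' x) ->
  f 0 = 0 -> 0 <= h -> 0 <= f h.
Proof.
move=> df f'0 f00 h0; rewrite -f00.
apply: (@ger0_derive1_le_cc _ f 0 h) => //.
- by move=> x; rewrite in_itv/= => /andP[x0 _];
    rewrite derive1E derive_val f'0// ltW.
- apply: continuous_subspaceT => x.
  exact/differentiable_continuous/derivable1_diffP.
- by rewrite in_itv/= lexx.
- by rewrite in_itv/= h0 lexx.
Qed.

(** Take logarithms: the gap between the exponents vanishes to first order at 0, and its second
    derivative [1/4 - u (1 - u)], with [u = p * expR x / D x], is nonnegative. *)
Lemma bernoulli_mgf_le (R : realType) (p h : R) : 0 <= p <= 1 -> 0 <= h ->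
  1 - p + p * expR h <= expR (p * h + h ^+ 2 / 8).
Proof.
move=> /andP[p0 p1] h0.
pose D (x : R) := 1 - p + p * expR x.
have D0 x : 0 < D x.
  have e0 := expR_gt0 x; rewrite /D.
  have [->|pn0] := eqVneq p 0; first by rewrite subr0 mul0r addr0.
  have pp : 0 < p by rewrite lt_neqAle eq_sym pn0.
  by rewrite ltr_wpDl ?subr_ge0// mulr_gt0.
have dD x : is_derive x (1 : R) D (p * expR x).
  rewrite /D; apply: is_derive_eq.
  by rewrite add0r mul1r.
have DU x : D x != 0 by rewrite gt_eqF.
(* [psi] is the derivative of [p * x + x ^+ 2 / 8 - ln (D x)]. *)
pose psi (x : R) := x / 4 + p - p * expR x / D x.
have psi_ge0 x : 0 <= x -> 0 <= psi x.
  apply: (@ge0_of_derive_ge0 _ _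
    (fun x => 4^-1 - (p * expR x) * (1 - p) / D x ^+ 2)).
  - move=> y; rewrite /psi.
    have dV := is_deriveV (DU y) (dD y).
    apply: is_derive_eq.
    rewrite /GRing.scale/= /D; have := DU y; rewrite /D => ?.
    by field.
  - move=> y y0; rewrite subr_ge0 ler_pdivrMr ?exprn_gt0//.
    (* [D y] is the sum of [1 - p] and [p * expR y], so their product is at most [D y ^+ 2 / 4]. *)
    have := sqr_ge0 ((1 - p) - p * expR y); rewrite /D; nra.
  - by rewrite /psi /D expR0; field; lra.
have lnD x : is_derive x (1 : R) (fun x => ln (D x)) (p * expR x / D x).
  have := @is_derive1_comp _ _ _ _ _ _ (is_derive1_ln (D0 x)) (dD x).
  by move=> /is_derive_eq; apply; rewrite /GRing.scale/= mulrC.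
suff : 0 <= p * h + h ^+ 2 / 8 - ln (D h).
  by rewrite subr_ge0 -(ler_expR (ln _)) lnK// posrE.
apply: (@ge0_of_derive_ge0 _ (fun h => p * h + h ^+ 2 / 8 - ln (D h)) psi) => //.
- move=> x; apply: is_derive_eq.
  by rewrite /psi /GRing.scale/=; field.
- by rewrite /D expR0 mulr1 subrK ln1; ring.
Qed.

Section BoundedProbability.
Context d (Omega : measurableType d) (R : realType) (P : probability Omega R).

Lemma bounded_rv_integrable (W : Omega -> R) (B : R) :
  measurable_fun setT W -> (forall w, `|W w| <= B) ->
  P.-integrable setT (EFin \o W).
Proof.
move=> mW WB; apply: measurable_bounded_integrable => //.
  by apply: le_lt_trans (probability_le1 P measurableT) _; rewrite ltry.
exists B; split; first exact: num_real.
by move=> M BM w _; exact: le_trans (WB w) (ltW BM).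
Qed.

Lemma osc_bounded (W : Omega -> R) (c : R) :
  (forall w w', `|W w - W w'| <= c) -> exists B, forall w, `|W w| <= B.
Proof.
move=> Wc; exists (`|W point| + c) => w.
by rewrite -[W w](subrK (W point)) addrC (le_trans (ler_normD _ _))// lerD2l.
Qed.

(* [W] takes values in [[a, a + c]] with [a] the infimum of its range; by
   convexity, [expR] lies below its chord there, which reduces the claim to a
   two-valued random variable. *)
Lemma hoeffding_lemma (W : Omega -> R) (c : R) :
  measurable_fun setT W -> (forall w w', `|W w - W w'| <= c) ->
  (\int[P]_w (expR (W w))%:E <=
   (expR (\int[P]_w W w + c ^+ 2 / 8))%:E)%E.
Proof.
move=> mW Wc.
have [B WB] := osc_bounded Wc.
have iW := bounded_rv_integrable mW WB.
have c0 : 0 <= c by exact: le_trans (normr_ge0 _) (Wc point point).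
pose a := inf (range W).
have lbW : has_lbound (range W).
  exists (- B) => _ [w _ <-]; by have := WB w; rewrite ler_norml => /andP[].
have aW w : a <= W w by apply: ge_inf => //; exists w.
have Wac w : W w <= a + c.
  rewrite -lerBlDr; apply: lb_le_inf; first by exists (W point), point.
  by move=> _ [w' _ <-]; have := Wc w w'; rewrite ler_norml => /andP[_]; lra.
pose m := \int[P]_w W w.
have mE : (\int[P]_w (W w)%:E = m%:E)%E.
  by rewrite fineK//; exact: integrable_fin_num.
have intc (r : R) : (\int[P]_w r%:E = r%:E)%E.
  by rewrite integral_cst//= probability_setT mule1.
have ic (r : R) : P.-integrable setT (EFin \o cst r).
  exact: (@bounded_rv_integrable _ `|r|).
have am : a <= m.
  rewrite -lee_fin -mE -intc; apply: le_integral => //; first exact: ic.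
  by move=> w _; rewrite lee_fin.
have mac : m <= a + c.
  rewrite -lee_fin -mE -intc; apply: le_integral => //; first exact: ic.
  by move=> w _; rewrite lee_fin.
(* The chord degenerates when [c = 0]; then [W] is constantly equal to its mean. *)
have [c00|cn0] := eqVneq c 0.
  rewrite -/m; have Wm w : W w = m by have := aW w; have := Wac w; lra.
  rewrite (eq_integral (cst (expR m)%:E)); last by move=> w _; rewrite Wm.
  by rewrite intc c00 expr0n/= mul0r addr0.
have cp : 0 < c by rewrite lt_neqAle eq_sym cn0.
(* Slope and intercept of the chord of [expR] over [[a, a + c]]. *)
pose be := expR a * (expR c - 1) / c.
pose al := expR a - be * a.
have chord w : expR (W w) <= al + be * W w.
  have t01 : 0 <= (W w - a) / c <= 1.
    rewrite divr_ge0 ?subr_ge0//= ler_pdivrMr// mul1r; have := Wac w; lra.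
  have /andP[t0 t1] := t01.
  pose t : {i01 R} := Itv01 t0 t1.
  have := convex_expR t (a + c) a.
  rewrite !convRE/= /unstable.onem => h.
  apply: le_trans (le_trans _ h) _.
    by rewrite ler_expR le_eqVlt; apply/orP; left; apply/eqP; field.
  rewrite expRD /al /be le_eqVlt; apply/orP; left; apply/eqP; by field.
(* The chord at the mean [m] is [expR a * (1 - p + p * expR c)] with [p = (m - a) / c], the
   situation of [bernoulli_mgf_le]. *)
have -> : expR (\int[P]_w W w + c ^+ 2 / 8) =
    expR a * expR ((m - a) / c * c + c ^+ 2 / 8).
  by rewrite -expRD divfK//; congr expR; rewrite -/m; ring.
apply: (@le_trans _ _ (\int[P]_w (al%:E + be%:E * (W w)%:E))%E).
  apply: ge0_le_integral => //.
  - by apply/measurable_EFinP; exact: measurableT_comp.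
  - apply/measurable_EFinP; apply: measurable_funD => //.
    exact: measurable_funM.
  - by move=> w _; rewrite -EFinM -EFinD lee_fin chord.
have iZ : P.-integrable setT (fun w => be%:E * (W w)%:E)%E by exact: integrableZl.
rewrite integralD//; last exact: ic.
rewrite integralZl// intc mE -EFinM -EFinD lee_fin.
have lam01 : 0 <= (m - a) / c <= 1.
  by rewrite divr_ge0 ?subr_ge0//= ler_pdivrMr// mul1r lerBlDl.
have h := bernoulli_mgf_le lam01 c0.
apply: le_trans (ler_wpM2l (expR_ge0 a) h).
by rewrite /al /be le_eqVlt; apply/orP; left; apply/eqP; field.
Qed.

Lemma Rintegral_addr (W : Omega -> R) (r : R) :
  P.-integrable setT (EFin \o W) ->
  \int[P]_w (W w + r) = \int[P]_w W w + r.
Proof.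
move=> iW; have ir : P.-integrable setT (EFin \o cst r).
  exact: (@bounded_rv_integrable _ `|r|).
by rewrite RintegralD// Rintegral_cst//= probability_setT mulr1.
Qed.

End BoundedProbability.

(** * Laws of independent families on product spaces *)

Section ProductSigmaAlgebra.
Context (I : finType) (d : I -> measure_display)
  (T : forall i, measurableType (d i)).
Local Notation prodT := (prod_measurableType T).

Definition rectangle (B : forall i, set (T i)) : set prodT :=
  [set x | forall i, B i (x i)].

Lemma measurable_coord i : measurable_fun setT (fun x : prodT => x i).
Proof.
move=> _ B mB; apply: sub_sigma_algebra.
by exists i => //; exists B.
Qed.

Lemma measurable_fun_coordP d0 (X : measurableType d0) (h : X -> prodT) :
  (forall i, measurable_fun setT (fun w => h w i)) -> measurable_fun setT h.
Proof.
move=> mh; apply: (@measurability _ _ X prodT setT h (\bigcup_i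
  preimage_set_system [set: forall i, T i] (fun x => x i)
    (@measurable _ (T i))) erefl).
move=> _ [_ [i _ [B mB <-]] <-].
by rewrite setTI [X in measurable X](_ : _ = setT `&` (fun w => h w i) @^-1` B);
  [exact: mh|rewrite !setTI].
Qed.

Lemma measurable_rectangle B :
  (forall i, measurable (B i)) -> measurable (rectangle B).
Proof.
move=> mB; rewrite (_ : rectangle B = \bigcap_(i in [set` [set: I]%SET])
    (fun x : prodT => x i) @^-1` B i).
  apply: fin_bigcap_measurable => // i _.
  by rewrite -[X in measurable X]setTI; exact: measurable_coord.
by apply/seteqP; split=> x h i; [move=> _|]; apply: h; rewrite /= ?inE.
Qed.

(** Rectangles are stable under intersection and generate the product sigma-algebra: a cylinder is a
    rectangle with [setT] in every other coordinate. *)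
Lemma prod_measure_unique (R : realType) (m1 m2 : probability prodT R) :
  (forall B, (forall i, measurable (B i)) ->
     m1 (rectangle B) = m2 (rectangle B)) ->
  forall E, measurable E -> m1 E = m2 E.
Proof.
move=> m12 E mE.
pose G := [set rectangle B | B in [set B | forall i, measurable (B i)]].
have Gm : G `<=` measurable by move=> _ [B mB <-]; exact: measurable_rectangle.
apply: (@g_sigma_algebra_measure_unique _ R prodT G Gm (fun=> setT)) => //.
- move=> _; exists (fun=> setT); first by move=> i; exact: measurableT.
  by apply/seteqP; split.
- by rewrite bigcup_const//; exists 0%N.
- move=> _ _ [B mB <-] [C mC <-]; exists (fun i => B i `&` C i).
    by move=> i; exact: measurableI.
  apply/seteqP; split=> x.
    by move=> h; split=> i; have [] := h i.
  by move=> [h k] i; split; [exact: h|exact: k].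
- by move=> _ [B mB <-]; exact: m12.
- by move=> _; apply: le_lt_trans (probability_le1 m1 measurableT) _; rewrite ltry.
- move: E mE; apply: smallest_sub; first exact: smallest_sigma_algebra.
  move=> _ [i _ [B mB <-]]; apply: sub_sigma_algebra; rewrite setTI.
  exists (fun j => (@dfwith _ (fun i => set (T i)) (fun=> setT) i B j)).
    by move=> j; case: dfwithP.
  apply/seteqP; split=> x/=.
    by move=> /(_ i); rewrite dfwithin.
  by move=> Bx j; case: dfwithP.
Qed.

(** Both integrals are taken against image measures that agree on rectangles. The two sample spaces
    may differ: this serves to compare [Omega] with its square, and original inputs with sampled
    ones. *)
Lemma prod_law_unique (R : realType) d1 d2 (O1 : measurableType d1)
  (O2 : measurableType d2) (P1 : probability O1 R) (P2 : probability O2 R)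
  (X1 : O1 -> prodT) (X2 : O2 -> prodT) :
  measurable_fun setT X1 -> measurable_fun setT X2 ->
  (forall B, (forall i, measurable (B i)) ->
     P1 (X1 @^-1` rectangle B) = P2 (X2 @^-1` rectangle B)) ->
  forall f : prodT -> \bar R, measurable_fun setT f -> (forall x, 0 <= f x)%E ->
  (\int[P1]_w f (X1 w) = \int[P2]_w f (X2 w))%E.
Proof.
move=> mX1 mX2 X12 f mf f0.
pose Y1 : {mfun O1 >-> prodT} := HB.pack X1 (isMeasurableFun.Build _ _ _ _ _ mX1).
pose Y2 : {mfun O2 >-> prodT} := HB.pack X2 (isMeasurableFun.Build _ _ _ _ _ mX2).
rewrite -[LHS](@ge0_integral_distribution _ _ _ _ _ P1 Y1 f mf f0).
rewrite -[RHS](@ge0_integral_distribution _ _ _ _ _ P2 Y2 f mf f0).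
apply: eq_measure_integral => E mE _.
by apply: (@prod_measure_unique R (distribution P1 Y1) (distribution P2 Y2)).
Qed.

End ProductSigmaAlgebra.

Section Resampling.
Context (I : finType) (d : I -> measure_display)
  (T : forall i, measurableType (d i)) (d0 : measure_display)
  (Omega : measurableType d0) (R : realType) (P : probability Omega R)
  (X : forall i, Omega -> T i).
Hypothesis mX : forall i, measurable_fun setT (X i).
Hypothesis indX : mutually_independent P X.
Local Notation prodT := (prod_measurableType T).
Local Notation joint := (fun w => (fun i => X i w) : prodT).

Lemma independent_rectangle (B : forall i, set (T i)) :
  (forall i, measurable (B i)) ->
  P (joint @^-1` rectangle B) = (\prod_i P (X i @^-1` B i))%E.
Proof.
move=> mB; rewrite (eq_bigl [in [set: I]%SET]); last by move=> i; rewrite inE.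
rewrite -indX//; congr (P _).
by apply/seteqP; split=> w h i; [move=> _|]; apply: h; rewrite /= ?inE.
Qed.

Lemma measurable_joint : measurable_fun setT joint.
Proof. exact: measurable_fun_coordP. Qed.

Lemma measurable_dfwith i :
  measurable_fun setT (fun z : prodT * Omega => dfwith z.1 i (X i z.2) : prodT).
Proof.
apply: measurable_fun_coordP => j; have [<-|ij] := eqVneq i j.
  rewrite (_ : (fun _ => _) = X i \o snd); last first.
    by apply/funext => z/=; rewrite dfwithin.
  exact: measurableT_comp.
rewrite (_ : (fun _ => _) = (fun x : prodT => x j) \o fst); last first.
  by apply/funext => z/=; rewrite dfwithout.
by apply: measurableT_comp => //; exact: measurable_coord.
Qed.

(** Replacing coordinate [i] by an independent copy, read off the second factor of [P \x P],
    preserves the joint law; Tonelli's theorem then separates the two integrals. *)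
Lemma resample i (f : prodT -> \bar R) :
  measurable_fun setT f -> (forall x, 0 <= f x)%E ->
  (\int[P]_w f (joint w) =
   \int[P]_w \int[P]_w' f (dfwith (joint w) i (X i w')))%E.
Proof.
move=> mf f0.
pose h (z : Omega * Omega) : prodT := dfwith (joint z.1) i (X i z.2).
have mh : measurable_fun setT h.
  rewrite (_ : h = (fun z : prodT * Omega => dfwith z.1 i (X i z.2) : prodT)
    \o (fun z : Omega * Omega => (joint z.1, z.2)))//.
  apply: measurableT_comp; first exact: measurable_dfwith.
  apply: measurable_fun_pair; last exact: measurable_snd.
  exact: (measurableT_comp measurable_joint measurable_fst).
transitivity (\int[P \x P]_z f (h z))%E; last first.
  have mfh : measurable_fun setT (f \o h) := measurableT_comp mf mh.
  by rewrite (fubini_tonelli1 (f \o h))// => z; exact: f0.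
apply: (prod_law_unique (P2 := (P \x P)%E : probability _ _)) => //.
  exact: measurable_joint.
move=> B mB; rewrite independent_rectangle//.
(* The first factor constrains the coordinates other than [i], the second only coordinate [i], so
   independence is invoked for the complement of [i]. *)
have -> : h @^-1` rectangle B =
    (\bigcap_(j in [set` ~: [set i]%SET]) X j @^-1` B j) `*` (X i @^-1` B i).
  apply/seteqP; split=> [[w w']/= hB|[w w']/= [h1 h2] j].
    split=> [j|]; last by have := hB i; rewrite /h/= dfwithin.
    rewrite /= !inE => ji; have := hB j; rewrite /h/= dfwithout//.
    by rewrite eq_sym.
  rewrite /h/=; have [<-|ij] := eqVneq i j; first by rewrite dfwithin.
  by rewrite dfwithout//; apply: h1; rewrite /= !inE eq_sym.
have mXB j : measurable (X j @^-1` B j).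
  by rewrite -[X in measurable X]setTI; exact: mX.
rewrite [RHS](product_measure1E P P)//; last first.
  exact: fin_bigcap_measurable.
rewrite (bigD1 i)//= muleC; congr (_ * _)%E.
apply/esym; rewrite [LHS](indX (~: [set i])%SET mB).
by apply: eq_bigl => j; rewrite !inE.
Qed.

End Resampling.

(** * McDiarmid's inequality *)

(** The index type is left general because the joint sample is indexed by a dependent sum. *)
Definition bounded_differences {R : realType} {I : eqType} {T : I -> Type}
    (g : (forall i, T i) -> R) (c : I -> R) : Prop :=
  forall i (x y : forall i, T i), (forall j, j != i -> x j = y j) ->
    `|g x - g y| <= c i.

(** Pass from one point to the other by changing one coordinate at a time. The resulting boundedness
    is the source of integrability below. *)
Lemma bounded_differences_osc (R : realType) (I : finType) (T : I -> Type)
  (g : (forall i, T i) -> R) (c : I -> R) : bounded_differences g c ->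
  forall x y, `|g x - g y| <= \sum_i c i.
Proof.
move=> gc x y.
suff : forall (r : seq I) z, (forall j, j \notin r -> x j = z j) ->
    `|g x - g z| <= \sum_(i <- r) c i.
  by apply => j; rewrite mem_index_enum.
elim=> [|i r IH] z xz.
  have -> : x = z by apply: functional_extensionality_dep => j; exact: xz.
  by rewrite subrr normr0 big_nil.
pose z' := dfwith z i (x i).
have -> : g x - g z = (g z' - g z) + (g x - g z') by ring.
rewrite big_cons (le_trans (ler_normD _ _))// lerD//.
  by apply: gc => j ji; rewrite /z' dfwithout// eq_sym.
apply: IH => j jr; rewrite /z'; have [<-|ij] := eqVneq i j.
  by rewrite dfwithin.
by rewrite dfwithout//; apply: xz; rewrite inE negb_or eq_sym ij.
Qed.

Section McDiarmidInequality.
Context (I : finType) (d : I -> measure_display)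
  (T : forall i, measurableType (d i)) (d0 : measure_display)
  (Omega : measurableType d0) (R : realType) (P : probability Omega R)
  (X : forall i, Omega -> T i).
Hypothesis mX : forall i, measurable_fun setT (X i).
Hypothesis indX : mutually_independent P X.
Local Notation prodT := (prod_measurableType T).
Local Notation joint := (fun w => (fun i => X i w) : prodT).
Implicit Types (g : prodT -> R) (c : I -> R).

(** By independence, the conditional expectation of [g] given the coordinates other than [i]. It
    keeps all coordinates as arguments, although constant in [x i], so that an induction can stay on
    one product space. *)
Definition coord_mean i g (x : prodT) : R :=
  \int[P]_w g (dfwith x i (X i w)).

Lemma measurable_section g i (x : prodT) : measurable_fun setT g ->
  measurable_fun setT (fun w => g (dfwith x i (X i w))).
Proof.
move=> mg.
have m1 : measurable_fun setT (fun w => (x, w) : prodT * Omega).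
  by apply: measurable_fun_pair => //; exact: measurable_cst.
have := measurableT_comp (measurableT_comp mg (measurable_dfwith mX i)) m1.
by [].
Qed.

Lemma integrable_section g c i (x : prodT) : measurable_fun setT g ->
  bounded_differences g c ->
  P.-integrable setT (fun w => (g (dfwith x i (X i w)))%:E).
Proof.
move=> mg gc.
have [w w'|B WB] := @osc_bounded _ Omega R
  (fun w => g (dfwith x i (X i w))) (\sum_i c i).
  exact: bounded_differences_osc.
exact: (bounded_rv_integrable P (measurable_section i x mg) WB).
Qed.

Lemma coord_meanE g c i x : measurable_fun setT g -> bounded_differences g c ->
  ((coord_mean i g x)%:E = \int[P]_w (g (dfwith x i (X i w)))%:E)%E.
Proof.
move=> mg gc; rewrite /coord_mean /Rintegral fineK//.
exact/integrable_fin_num/(integrable_section _ _ mg gc).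
Qed.

Lemma measurable_coord_mean g c i : measurable_fun setT g ->
  (forall x, 0 <= g x) -> bounded_differences g c ->
  measurable_fun setT (coord_mean i g : prodT -> R).
Proof.
move=> mg g0 gc.
pose f (z : prodT * Omega) : \bar R := (g (dfwith z.1 i (X i z.2)))%:E.
have mf : measurable_fun setT f.
  by apply/measurable_EFinP; exact: (measurableT_comp mg (measurable_dfwith mX i)).
have f0 z : (0 <= f z)%E by rewrite lee_fin.
apply/measurable_EFinP.
have := @measurable_fun_fubini_tonelli_F _ _ _ _ _ P f mf f0.
by apply: eq_measurable_fun => x _; rewrite /fubini_F /= (coord_meanE _ _ mg gc).
Qed.

(** Coordinate [i] is overwritten, so it has no influence; the differences in the other coordinates
    are bounded under the integral. *)
Lemma bounded_differences_coord_mean g c i : measurable_fun setT g ->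
  bounded_differences g c ->
  bounded_differences (coord_mean i g) (fun j => if j == i then 0 else c j).
Proof.
move=> mg gc j x y xy; have [ji|ji] := eqVneq j i.
  rewrite (_ : coord_mean i g x = coord_mean i g y) ?subrr ?normr0//.
  rewrite /coord_mean; apply: eq_Rintegral => w _; congr g.
  apply: functional_extensionality_dep => k; have [<-|ik] := eqVneq i k.
    by rewrite !dfwithin.
  by rewrite !dfwithout// xy// ji eq_sym.
have ix := integrable_section i x mg gc.
have iy := integrable_section i y mg gc.
have ixy : P.-integrable setT (EFin \o
    (fun w => g (dfwith x i (X i w)) - g (dfwith y i (X i w)))).
  exact: (integrableB measurableT ix iy).
rewrite /coord_mean -RintegralB//.
apply: le_trans (le_normr_Rintegral _ ixy) _ => //.
have ic : P.-integrable setT (EFin \o cst (c j)).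
  exact: (@bounded_rv_integrable _ _ _ P _ `|c j|).
rewrite (_ : c j = \int[P]_w cst (c j) w); last first.
  by rewrite Rintegral_cst//= probability_setT mulr1.
apply: le_Rintegral => //.
  exact: (integrable_norm ixy).
move=> w _; apply: gc => k kj; have [<-|ik] := eqVneq i k.
  by rewrite !dfwithin.
by rewrite !dfwithout// xy.
Qed.

Lemma integrable_joint g c : measurable_fun setT g ->
  bounded_differences g c -> P.-integrable setT (fun w => (g (joint w))%:E).
Proof.
move=> mg gc.
have [w w'|B WB] := @osc_bounded _ Omega R (fun w => g (joint w)) (\sum_i c i).
  exact: bounded_differences_osc.
exact: (bounded_rv_integrable P (measurableT_comp mg (measurable_joint mX)) WB).
Qed.

(* Averaging out one coordinate costs [expR (c i ^+ 2 / 8)] by Hoeffding's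
   lemma and makes the function independent of that coordinate; nonnegativity
   of [g] only serves to apply Tonelli's theorem. *)
Lemma mgf_bounded_differences_ge0 (s : seq I) g c :
  measurable_fun setT g -> (forall x, 0 <= g x) -> bounded_differences g c ->
  (forall i, i \notin s -> c i = 0) ->
  (\int[P]_w (expR (g (joint w)))%:E <=
   (expR (\int[P]_w g (joint w) + (\sum_i c i ^+ 2) / 8))%:E)%E.
Proof.
elim: s g c => [|i s IH] g c mg g0 gc c0.
  (* All differences are zero here, so [g] is constant. *)
  have gE w : g (joint w) = g (joint point).
    apply/eqP; rewrite -subr_eq0 -normr_le0.
    apply: le_trans (bounded_differences_osc gc _ _) _.
    by rewrite big1// => i _; exact: c0.
  rewrite (eq_integral (cst (expR (g (joint point)))%:E)); last first.
    by move=> w _; rewrite gE.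
  rewrite (@eq_Rintegral _ _ _ P setT (cst (g (joint point)))); last first.
    by move=> w _; rewrite gE.
  rewrite integral_cst// Rintegral_cst//= probability_setT mule1 mulr1.
  rewrite lee_fin ler_expR lerDl divr_ge0// sumr_ge0// => i _.
  exact: sqr_ge0.
have mexp : measurable_fun setT (@expR R) by exact: measurable_expR.
pose c' j := if j == i then 0 else c j.
have gc' := bounded_differences_coord_mean i mg gc.
have mc := measurable_coord_mean i mg g0 gc.
have meg : measurable_fun setT (fun x : prodT => (expR (g x))%:E).
  by apply/measurable_EFinP; exact: (measurableT_comp mexp mg).
rewrite (resample mX indX i meg); last by move=> x; rewrite lee_fin expR_ge0.
(* With the other coordinates frozen, the section of [g] has oscillation at most [c i] and mean
   [coord_mean i g]. *)
have step w : (\int[P]_w' (expR (g (dfwith (joint w) i (X i w'))))%:E <=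
    (expR (c i ^+ 2 / 8))%:E * (expR (coord_mean i g (joint w)))%:E)%E.
  rewrite -EFinM -expRD addrC.
  apply: hoeffding_lemma; first exact: measurable_section.
  move=> w1 w2; apply: gc => j ji.
  by rewrite !dfwithout// eq_sym.
have mem : measurable_fun setT (fun x : prodT => (expR (coord_mean i g x))%:E).
  by apply/measurable_EFinP; exact: (measurableT_comp mexp mc).
have memj : measurable_fun setT (fun w => (expR (coord_mean i g (joint w)))%:E).
  exact: (measurableT_comp mem (measurable_joint mX)).
apply: (@le_trans _ _ (\int[P]_w ((expR (c i ^+ 2 / 8))%:E *
    (expR (coord_mean i g (joint w)))%:E))%E).
  apply: ge0_le_integral => //.
  - by move=> w _; apply: integral_ge0 => w' _; rewrite lee_fin expR_ge0.
  - pose f (z : prodT * Omega) : \bar R :=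
      (expR (g (dfwith z.1 i (X i z.2))))%:E.
    have mf : measurable_fun setT f.
      exact: (measurableT_comp meg (measurable_dfwith mX i)).
    have f0 z : (0 <= f z)%E by rewrite lee_fin expR_ge0.
    have mF := @measurable_fun_fubini_tonelli_F _ _ _ _ _ P f mf f0.
    exact: (measurableT_comp mF (measurable_joint mX)).
  - exact: measurable_funeM.
rewrite ge0_integralZl//.
have cs j : j \notin s -> c' j = 0.
  rewrite /c'; case: eqVneq => // ji js.
  by apply: c0; rewrite inE negb_or ji.
have cm0 x : 0 <= coord_mean i g x by exact: Rintegral_ge0.
have IHc := IH _ _ mc cm0 gc' cs.
apply: le_trans (lee_wpmul2l _ IHc) _; first by rewrite lee_fin expR_ge0.
(* Tower property, by resampling in [g] itself. *)
have <- : \int[P]_w g (joint w) = \int[P]_w coord_mean i g (joint w).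
  rewrite /Rintegral; congr fine.
  have mge : measurable_fun setT (fun x : prodT => (g x)%:E).
    exact/measurable_EFinP.
  rewrite (resample mX indX i mge); last by move=> x; rewrite lee_fin.
  by apply: eq_integral => w _; rewrite (coord_meanE _ _ mg gc).
rewrite -EFinM -expRD lee_fin ler_expR.
rewrite [X in _ <= _ + X / 8](bigD1 i)//= [X in _ + (_ + X / 8)](bigD1 i)//=.
rewrite /c' eqxx expr0n/= add0r.
rewrite [X in _ + (_ + X / 8)](eq_bigr (fun j => c j ^+ 2)); last first.
  by move=> j /negPf ->.
by rewrite le_eqVlt; apply/orP; left; apply/eqP; ring.
Qed.

(** The oscillation bound makes [g + K] nonnegative for a suitable constant [K], and the factor
    [expR K] cancels from both sides. *)
Lemma mgf_bounded_differences g c : measurable_fun setT g ->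
  bounded_differences g c ->
  (\int[P]_w (expR (g (joint w)))%:E <=
   (expR (\int[P]_w g (joint w) + (\sum_i c i ^+ 2) / 8))%:E)%E.
Proof.
move=> mg gc.
pose K := \sum_i c i - g point.
pose h x := g x + K.
have h0 x : 0 <= h x.
  have := bounded_differences_osc gc x point.
  by rewrite ler_norml /h /K => /andP[+ _]; lra.
have mh : measurable_fun setT h by exact: measurable_funD.
have hc : bounded_differences h c.
  move=> i x y xy; rewrite /h (_ : _ - _ = g x - g y); last by ring.
  exact: gc.
have := @mgf_bounded_differences_ge0 (enum I) h c mh h0 hc.
have mgj := measurableT_comp mg (measurable_joint mX).
have mexp : measurable_fun setT (@expR R) by exact: measurable_expR.
have -> : \int[P]_w h (joint w) = \int[P]_w g (joint w) + K.
  by rewrite Rintegral_addr//; exact: integrable_joint gc.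
have -> : (\int[P]_w (expR (h (joint w)))%:E =
    (expR K)%:E * \int[P]_w (expR (g (joint w)))%:E)%E.
  rewrite -ge0_integralZl//.
  - by apply: eq_integral => w _; rewrite -EFinM -expRD addrC.
  - by apply/measurable_EFinP; exact: (measurableT_comp mexp mgj).
rewrite addrAC [expR (_ + K)]expRD [expR _ * expR K]mulrC EFinM.
rewrite lee_pmul2l ?lte_fin ?expR_gt0//.
by apply=> i; rewrite mem_enum.
Qed.

(** Chernoff's bound for [- g], whose moment generating function at [l] is that of a function with
    differences [l * c i]. The parameter [l] stays free: the degenerate case [Psi = 0] calls for a
    choice other than the usual optimum. *)
Lemma mcdiarmid_chernoff g c (l t : R) : measurable_fun setT g ->
  bounded_differences g c -> 0 <= l ->
  (P [set w | (g (joint w) <= \int[P]_w g (joint w) - t)%R] <=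
   (expR (l ^+ 2 * (\sum_i c i ^+ 2) / 8 - l * t))%:E)%E.
Proof.
(* [chernoff] asks for [0 < l]; at [l = 0] the bound is 1. *)
move=> mg gc; rewrite le_eqVlt => /predU1P[<-|l0].
  rewrite expr0n/= !mul0r subrr expR0; apply: probability_le1.
  rewrite -[X in measurable X]setTI.
  have mgj := measurableT_comp mg (measurable_joint mX).
  exact: measurable_fun_le.
pose h x := - l * g x.
have mh : measurable_fun setT (h : prodT -> R) by exact: measurable_funM.
have mgj := measurableT_comp mg (measurable_joint mX).
have hc : bounded_differences h (fun i => l * c i).
  move=> i x y xy; rewrite /h -[in leLHS]mulrBr normrM normrN (gtr0_norm l0).
  by apply: ler_wpM2l (ltW l0) _ _ _; apply: gc.
have mgf := mgf_bounded_differences mh hc.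
have mXl : measurable_fun setT (fun w => - g (joint w)) by exact: measurable_funN.
pose W : {RV P >-> R} := HB.pack (fun w => - g (joint w))
  (isMeasurableFun.Build _ _ _ _ _ mXl).
set m := \int[P]_w g (joint w).
have chW := chernoff W (t - m) l0.
have -> : [set w | g (joint w) <= m - t] = [set w | t - m <= W w].
  by apply: eq_set => w; congr is_true; rewrite [RHS]lerNr opprB.
apply: le_trans chW _.
have -> : 'M_P W l = (\int[P]_w (expR (h (joint w)))%:E)%E.
  rewrite /mmt_gen_fun unlock; apply: eq_integral => w _ /=.
  by congr (expR _)%:E; rewrite /h; ring.
apply: le_trans (lee_wpmul2r _ mgf) _; first by rewrite lee_fin expR_ge0.
rewrite /h RintegralZl//; last exact: integrable_joint gc.
rewrite -EFinM -expRD lee_fin ler_expR -/m.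
rewrite (eq_bigr (fun i => l ^+ 2 * c i ^+ 2)); last by move=> i _; rewrite exprMn.
by rewrite -mulr_sumr le_eqVlt; apply/orP; left; apply/eqP; ring.
Qed.

End McDiarmidInequality.

(** * Borel sets of row vectors *)

Section RowVectorBorel.
Context {R : realType} {N : nat}.

(** Balls of row vectors are boxes, so each point of [U] has a rational box around it inside [U].
    Boxes not inside [U] are replaced by [set0], which keeps the union over a countable type. *)
Lemma open_rV_bigcup_rat_box (U : set 'rV[R]_N) : open U ->
  let box (q : {ffun 'I_N -> rat * rat}) : set 'rV[R]_N :=
    [set x | forall n, ratr (q n).1 < x 0 n < ratr (q n).2] in
  U = \bigcup_q (if `[< box q `<=` U >] then box q else set0).
Proof.
move=> oU box; apply/seteqP; split=> [x Ux|x [q _]]; last first.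
  by case: asboolP => // boxU /boxU.
have /nbhs_ballP[e /= e0 xeU] : nbhs x U by apply: open_nbhs_nbhs; split.
have hq n : exists q : rat * rat,
    x 0 n - e < ratr q.1 < x 0 n /\ x 0 n < ratr q.2 < x 0 n + e.
  have [|a] := @rat_in_itvoo R (x 0 n - e) (x 0 n); first by lra.
  have [|b] := @rat_in_itvoo R (x 0 n) (x 0 n + e); first by lra.
  by rewrite !in_itv/= => hb ha; exists (a, b).
have [q qP] := choice hq.
exists [ffun n => q n] => //; rewrite asboolT; last first.
  move=> y /= yq; apply: xeU; split=> // i j; rewrite (ord1 i).
  have := yq j; rewrite ffunE => /andP[y1 y2].
  have [/andP[q1 q2] /andP[q3 q4]] := qP j.
  by rewrite /ball/= ltr_norml; apply/andP; split; lra.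
move=> n; rewrite ffunE.
by have [/andP[q1 q2] /andP[q3 q4]] := qP n; apply/andP.
Qed.

(** The sets with measurable preimage form a sigma-algebra; it contains the open sets, as countable
    unions of boxes. *)
Lemma measurable_preimage_borel_rV d (Omega : measurableType d)
  (V : Omega -> 'rV[R]_N) (A : set 'rV[R]_N) :
  (forall n, measurable_fun setT (fun w => V w 0 n)) -> borel_set A ->
  measurable (V @^-1` A).
Proof.
move=> mV; move: A; apply: (@smallest_sub _ _ _
    [set A | measurable (V @^-1` A)]).
  split; first by rewrite /= preimage_set0.
  - by move=> A mA; rewrite /= setTD preimage_setC; exact: measurableC.
  - by move=> F mF; rewrite /= preimage_bigcup; exact: bigcupT_measurable.
move=> U /open_rV_bigcup_rat_box /= ->; rewrite /= preimage_bigcup.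
apply: countable_bigcupT_measurable; first exact: countableP.
move=> q; case: asboolP => _; last by rewrite preimage_set0.
rewrite (_ : _ @^-1` _ = \bigcap_(n in [set` [set: 'I_N]%SET])
    ((fun w => V w 0 n) @^-1` `](ratr (q n).1), (ratr (q n).2)[)).
  apply: fin_bigcap_measurable => // n _.
  by rewrite -[X in measurable X]setTI; apply: mV.
apply/seteqP; split=> w h n.
  by move=> _; rewrite /= in_itv/=; exact: h.
by have := h n; rewrite /= in_itv/= inE; apply.
Qed.

End RowVectorBorel.

(** * Passing the exponential bound to a supremum *)

Lemma expeR_half_sqrE (R : realType) (t : R) :
  (expeR (- (t%:E ^+ 2 / 2%:E)) = (expR (- (t ^+ 2 / 2)))%:E)%E.
Proof. by rewrite -EFin_expe inver pnatr_eq0/=. Qed.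

(** For [q = r > 0] the bound at [z] reads [z <= sqrt (- 2 ln r)], which does not depend on [z] and
    so passes to the supremum. Having 0 in [S] makes the supremum nonnegative, so that squaring is
    monotone. *)
Lemma le_expeR_sup_sqr (R : realType) (q : \bar R) (S : set \bar R) :
  (0 <= q <= 1)%E -> S 0%E ->
  (forall z, S z -> 0 <= z /\ q <= expeR (- (z ^+ 2 / 2%:E)))%E ->
  (q <= expeR (- (ereal_sup S ^+ 2 / 2%:E)))%E.
Proof.
move=> q01 S0 Sq.
have [->|qn0] := eqVneq q 0%E; first exact: expeR_ge0.
case: q q01 qn0 Sq => [r| |]; last 2 first.
- by rewrite leye_eq => /andP[_ /eqP].
- by rewrite leeNy_eq => /andP[/eqP].
rewrite !lee_fin eqe => /andP[r0 r1] rn0 Sq.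
have rp : 0 < r by rewrite lt_neqAle eq_sym rn0.
have L0 : ln r <= 0 by rewrite ln_le0.
pose s := Num.sqrt (- (2 * ln r)).
have s0 : 0 <= s by exact: sqrtr_ge0.
have s2 : s ^+ 2 = - (2 * ln r) by rewrite sqr_sqrtr//; lra.
have Ss : ubound S s%:E.
  move=> z /Sq[]; case: z => [z| |]; last by rewrite leeNy_eq.
    rewrite !lee_fin expeR_half_sqrE lee_fin => z0 rz.
    rewrite -(ler_pXn2r (n := 2))// ?nnegrE// s2.
    have : ln r <= - (z ^+ 2 / 2) by rewrite -ler_expR lnK// posrE.
    lra.
  (* The value [+oo] is excluded: it would force [r <= 0]. *)
  move=> _; rewrite expe2 mulyy inver pnatr_eq0/= mulr_infty gtr0_sg ?invr_gt0//.
  by rewrite mul1e /= lee_fin leNgt rp.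
have : (ereal_sup S <= s%:E)%E by exact: ge_ereal_sup.
have : (0 <= ereal_sup S)%E by exact: ereal_sup_ubound.
case: (ereal_sup S) => [t| |]//.
rewrite !lee_fin expeR_half_sqrE lee_fin => t0 ts.
rewrite -[leLHS]lnK ?posrE// ler_expR.
have : t ^+ 2 <= s ^+ 2 by rewrite ler_pXn2r.
rewrite s2; lra.
Qed.

(** Extracts, from the independence of all samples, that of the inputs of a single replica of
    [f n]. *)
Lemma mutually_independent_reindex d0 (Omega : measurableType d0) (R : realType)
  (P : probability Omega R) (I J : finType) (d : I -> measure_display)
  (T : forall i, measurableType (d i)) (X : forall i, Omega -> T i)
  (h : J -> I) : injective h -> mutually_independent P X ->
  mutually_independent P (fun j => X (h j)).
Proof.
move=> hI indX K B mB.
(* The family [B] transported along [h], and [setT] off the range of [h]. *)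
pose C i : set (T i) := [set y | forall j (e : h j = i),
  eq_rect (h j) (fun i => set (T i)) (B j) i e y].
have CE j : C (h j) = B j.
  apply/seteqP; split=> y; first by move=> /(_ j erefl).
  (* Injectivity leaves only the transport along a loop, trivial since equality on [I] is
     decidable. *)
  by move=> By k e; have kj := hI _ _ e; subst k; rewrite (eq_irrelevance e erefl).
have mC i : measurable (C i).
  have [/existsP[j /eqP <-]|/existsPn hi] := boolP [exists j, h j == i].
    by rewrite CE.
  rewrite (_ : C i = setT)//; apply/seteqP; split=> // y _ j e.
  by case/negP: (hi j); apply/eqP.
have := indX (h @: K)%SET C mC.
rewrite big_imset/=; last by move=> ? ? _ _; exact: hI.
under [in X in _ = X -> _]eq_bigr do rewrite CE.
move=> <-; congr (P _); apply/seteqP; split=> w H i /=.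
  by move=> /imsetP[j jK ->]; rewrite CE; exact: H.
move=> iK; rewrite -CE; apply: H => /=; exact: imset_f.
Qed.

Lemma Rintegral_sum d (Omega : measurableType d) (R : realType)
  (mu : {measure set Omega -> \bar R}) (I : Type) (s : seq I)
  (F : I -> Omega -> R) :
  (forall i, mu.-integrable setT (EFin \o F i)) ->
  \int[mu]_w (\sum_(i <- s) F i w) = \sum_(i <- s) \int[mu]_w F i w.
Proof.
move=> iF; elim: s => [|i s IH].
  rewrite big_nil (@eq_Rintegral _ _ _ mu setT (cst 0)); last first.
    by move=> w _; rewrite big_nil.
  by rewrite Rintegral_cst// mul0r.
rewrite big_cons -IH -RintegralD//.
  by apply: eq_Rintegral => w _; rewrite big_cons.
have := integrable_sum (mu := mu) measurableT s (P := predT)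
  (h := fun i w => (F i w)%:E) (fun i _ => iF i).
by apply: eq_integrable => // w _; rewrite /= sumEFin.
Qed.

(** Independence and equal marginals give equal probabilities to rectangles. As above, a shift by
    [K] makes [g] nonnegative. *)
Lemma Rintegral_law_unique (I : finType) (d : I -> measure_display)
  (T : forall i, measurableType (d i)) (R : realType)
  d1 d2 (O1 : measurableType d1) (O2 : measurableType d2)
  (P1 : probability O1 R) (P2 : probability O2 R)
  (X1 : forall i, O1 -> T i) (X2 : forall i, O2 -> T i)
  (mX1 : forall i, measurable_fun setT (X1 i))
  (mX2 : forall i, measurable_fun setT (X2 i))
  (ind1 : mutually_independent P1 X1) (ind2 : mutually_independent P2 X2)
  (X12 : forall i B, measurable B -> P1 (X1 i @^-1` B) = P2 (X2 i @^-1` B))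
  (g : prod_measurableType T -> R) (c : I -> R) :
  measurable_fun setT g -> bounded_differences g c ->
  \int[P1]_w g (fun i => X1 i w) = \int[P2]_w g (fun i => X2 i w).
Proof.
move=> mg gc.
pose K := \sum_i c i - g point.
have h0 x : (0 <= (g x + K)%:E)%E.
  have := bounded_differences_osc gc x point.
  by rewrite lee_fin ler_norml /K => /andP[+ _]; lra.
have mh : measurable_fun setT (fun x => (g x + K)%:E).
  by apply/measurable_EFinP; exact: measurable_funD.
have := prod_law_unique (measurable_joint mX1) (measurable_joint mX2) _ mh h0.
move=> /(_ P1 P2) E.
suff H : \int[P1]_w (g (fun i => X1 i w) + K) =
    \int[P2]_w (g (fun i => X2 i w) + K).
  apply: (addIr K); rewrite -!Rintegral_addr//.
  - exact: (integrable_joint P2 mX2 mg gc).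
  - exact: (integrable_joint P1 mX1 mg gc).
rewrite /Rintegral; congr fine; apply: E => B mB.
rewrite !independent_rectangle//.
by apply: eq_bigr => i _; exact: X12.
Qed.

(** * Empirical averages *)

Section McDiarmidDiameter.
Context {R : realType} {K : nat} {T : 'I_K -> Type}.
Variables (f : (forall k, T k) -> R) (x0 : forall k, T k).
Hypothesis hD : (mcdiarmid_diam f < +oo)%E.

(** The pair [(x0, x0)] shows that the supremum is at least 0, hence not [-oo]; an infinite
    subdiameter would make the sum of squares infinite. *)
Lemma mcdiarmid_subdiam_fin_num k : mcdiarmid_subdiam f k \is a fin_num.
Proof.
have D0 : (0 <= mcdiarmid_subdiam f k)%E.
  by apply: ereal_sup_ubound; exists x0, x0; rewrite subrr normr0.
have S0 : (0 <= \sum_(k < K) mcdiarmid_subdiam f k ^+ 2)%E.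
  by apply: sume_ge0 => j _; exact: sqre_ge0.
have : mcdiarmid_diam f \is a fin_num by rewrite ge0_fin_numE// sqrte_ge0.
rewrite sqrte_fin_num// => /sum_fin_numP/(_ k (mem_index_enum _) isT).
by case: (mcdiarmid_subdiam f k) D0.
Qed.

Lemma mcdiarmid_diamE :
  fine (mcdiarmid_diam f) ^+ 2 = \sum_(k < K) fine (mcdiarmid_subdiam f k) ^+ 2.
Proof.
have -> : mcdiarmid_diam f =
    sqrte (\sum_(k < K) fine (mcdiarmid_subdiam f k) ^+ 2)%:E.
  rewrite /mcdiarmid_diam -sumEFin; congr sqrte; apply: eq_bigr => k _.
  by rewrite EFin_expe fineK// mcdiarmid_subdiam_fin_num.
by rewrite /= sqr_sqrtr// sumr_ge0// => k _; exact: sqr_ge0.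
Qed.

Lemma bounded_differences_subdiam :
  bounded_differences f (fun k => fine (mcdiarmid_subdiam f k)).
Proof.
move=> k x y xy; rewrite -lee_fin fineK ?mcdiarmid_subdiam_fin_num//.
by apply: ereal_sup_ubound; exists x, y.
Qed.

End McDiarmidDiameter.

(** * Linear functionals of the empirical average *)

Section Sampling.
Context {R : realType} {N : nat} {K M : 'I_N -> nat}
  {d : forall n : 'I_N, 'I_(K n) -> measure_display}
  {T : forall (n : 'I_N) (k : 'I_(K n)), measurableType (@d n k)}.
Variable f : forall n : 'I_N, (forall k : 'I_(K n), @T n k) -> R.
Hypothesis hM : forall n, (1 <= M n)%N.
Hypothesis mf : forall n : 'I_N, measurable_fun [set: prod_measurableType (@T n)]
  (@f n : prod_measurableType (@T n) -> R).
Hypothesis hD : forall n : 'I_N, (mcdiarmid_diam (@f n) < +oo)%E.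

Local Notation index := {n : 'I_N & ('I_(K n) * 'I_(M n))%type}.
Local Notation sampleT := (fun i : index => @T (tag i) (tagged i).1).
Implicit Type nu : 'rV[R]_N.

Definition sample_index n (k : 'I_(K n)) (m : 'I_(M n)) : index :=
  Tagged (fun n => ('I_(K n) * 'I_(M n))%type) (k, m).

(** The pairing of [nu] with the empirical average, seen as a function of the whole joint sample so
    that McDiarmid's inequality applies. *)
Definition weighted_average nu (x : prod_measurableType sampleT) : R :=
  \sum_n nu 0 n * ((M n)%:R^-1 * \sum_m @f n (fun k => x (@sample_index n k m))).

Definition weighted_subdiam nu (i : index) : R :=
  `|nu 0 (tag i)| / (M (tag i))%:R *
  fine (mcdiarmid_subdiam (@f (tag i)) (tagged i).1).

Lemma measurable_weighted_average nu :
  measurable_fun setT (weighted_average nu).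
Proof.
apply: measurable_sum => n; apply: measurable_funM => //.
apply: measurable_funM => //; apply: measurable_sum => m.
have ms : measurable_fun setT (fun x : prod_measurableType sampleT =>
    (fun k => x (@sample_index n k m)) : prod_measurableType (@T n)).
  apply: measurable_fun_coordP => k.
  exact: (@measurable_coord _ _ sampleT (sample_index k m)).
exact: (measurableT_comp (@mf n) ms).
Qed.

(** The sample [(n, k, m)] enters only replica [m] of [f n], which has weight [nu 0 n / M n]. *)
Lemma bounded_differences_weighted_average nu :
  bounded_differences (weighted_average nu) (weighted_subdiam nu).
Proof.
move=> [n [k m]] x y xy.
rewrite /weighted_average -sumrB (bigD1 n)//= [X in _ + X]big1 ?addr0; last first.
  move=> n' nn'; apply/eqP; rewrite subr_eq0; apply/eqP.
  congr (_ * (_ * _)); apply: eq_bigr => m' _; congr (@f _ _).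
  apply: functional_extensionality_dep => k'; apply: (xy (sample_index k' m')).
  by apply: contra_neq nn' => /(congr1 tag).
rewrite -!mulrBr -sumrB (bigD1 m)//= [X in _ + X]big1 ?addr0; last first.
  move=> m' mm'; apply/eqP; rewrite subr_eq0; apply/eqP.
  congr (@f _ _); apply: functional_extensionality_dep => k'.
  apply: (xy (sample_index k' m')).
  by rewrite eq_Tagged xpair_eqE negb_and mm' orbT.
rewrite /weighted_subdiam /= 2!normrM mulrA [`|_^-1|]ger0_norm ?invr_ge0//.
apply: ler_wpM2l; first by rewrite mulr_ge0// invr_ge0.
apply: (bounded_differences_subdiam (fun k => point) (hD n)) => j jk.
by apply: (xy (sample_index j m)); rewrite eq_Tagged xpair_eqE negb_and jk.
Qed.

(** For each [n] and [k] there are [M n] equal terms carrying [(M n) ^- 2], which leaves one factor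
    [(M n)^-1]; the 4 offsets the square of the [1/2] in [sampling_Psi]. *)
Lemma sum_weighted_subdiam nu :
  \sum_i weighted_subdiam nu i ^+ 2 = 4 * sampling_Psi M f nu ^+ 2.
Proof.
rewrite /sampling_Psi exprMn sqr_sqrtr; last first.
  apply: sumr_ge0 => n _; apply: divr_ge0 => //.
  by apply: mulr_ge0; exact: sqr_ge0.
rewrite mulrA (_ : 4 * _ = 1) ?mul1r; last by field.
rewrite /weighted_subdiam.
have := @sig_big_dep R 0 +%R 'I_N (fun n => ('I_(K n) * 'I_(M n))%type) predT
  (fun _ => predT) (fun n km => (`|nu 0 n| / (M n)%:R *
    fine (mcdiarmid_subdiam (@f n) km.1)) ^+ 2).
move=> <-; apply: eq_bigr => n _.
rewrite -(pair_bigA _ (fun k m => (`|nu 0 n| / (M n)%:R *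
    fine (mcdiarmid_subdiam (@f n) k)) ^+ 2))/=.
rewrite (mcdiarmid_diamE (fun k => point) (hD n)).
rewrite mulr_sumr mulr_suml; apply: eq_bigr => k _.
rewrite sumr_const card_ord !exprMn -mulr_natr real_normK ?num_real//.
have : (M n)%:R != 0 :> R by rewrite pnatr_eq0 -lt0n hM.
by move=> Mn; field.
Qed.

Context {d1 d2 : measure_display} {Omega : measurableType d1}
  {Omega' : measurableType d2} (P : probability Omega R)
  (Q : probability Omega' R)
  (Y : forall (n : 'I_N) (k : 'I_(K n)), {RV P >-> @T n k})
  (Ys : forall (n : 'I_N) (k : 'I_(K n)), 'I_(M n) -> {RV Q >-> @T n k}).
Local Notation sample := (fun i : index =>
  (@Ys (tag i) (tagged i).1 (tagged i).2 : Omega' -> @T (tag i) (tagged i).1)).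
Local Notation average := (empirical_average f
  (fun n k m => @Ys n k m : Omega' -> @T n k)).
Hypothesis indY : forall n : 'I_N, mutually_independent P
  (fun k : 'I_(K n) => (@Y n k : Omega -> @T n k)).
Hypothesis indYs : mutually_independent Q sample.
Hypothesis distYs : forall (n : 'I_N) (k : 'I_(K n)) (m : 'I_(M n))
  (B : set (@T n k)), measurable B ->
  distribution Q (@Ys n k m) B = distribution P (@Y n k) B.

Lemma pairing_empirical_average nu w :
  pairing nu (average w) = weighted_average nu (fun i => sample i w).
Proof. by apply: eq_bigr => n _; rewrite mxE. Qed.

Lemma measurable_sample i : measurable_fun setT (sample i).
Proof. by []. Qed.

Lemma measurable_replica n (m : 'I_(M n)) : measurable_fun setT
  (fun w => @f n (fun k => @Ys n k m w)).
Proof.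
have mj := @measurable_joint _ _ (@T n) _ Omega'
  (fun k => @Ys n k m : Omega' -> @T n k) (fun k => measurable_funPT _).
exact: (measurableT_comp (@mf n) mj).
Qed.

(** By linearity, it suffices that each replica has the mean of [f n] at the original inputs; its
    own inputs are independent with the same laws. *)
Lemma Rintegral_weighted_average nu :
  \int[Q]_w weighted_average nu (fun i => sample i w) =
  pairing nu (mean_vector P (fun n w => @f n (fun k => @Y n k w))).
Proof.
have mYs n m (k : 'I_(K n)) :
  measurable_fun setT (@Ys n k m : Omega' -> @T n k) by [].
have mY n (k : 'I_(K n)) : measurable_fun setT (@Y n k : Omega -> @T n k) by [].
have bf n := bounded_differences_subdiam (fun k => point) (hD n).
have iF n (m : 'I_(M n)) : Q.-integrable setT
    (EFin \o (fun w => @f n (fun k => @Ys n k m w))).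
  exact: (integrable_joint Q (mYs n m) (@mf n) (bf n)).
have iS n : Q.-integrable setT
    (EFin \o (fun w => \sum_m @f n (fun k => @Ys n k m w))).
  have := integrable_sum (mu := Q) measurableT (index_enum 'I_(M n)) (P := predT)
    (h := fun m w => (@f n (fun k => @Ys n k m w))%:E) (fun m _ => iF n m).
  by apply: eq_integrable => // w _; rewrite /= sumEFin.
have iM n : Q.-integrable setT
    (EFin \o (fun w => (M n)%:R^-1 * \sum_m @f n (fun k => @Ys n k m w))).
  exact: (integrableZl measurableT _ (iS n)).
rewrite /weighted_average Rintegral_sum; last first.
  by move=> n; exact: (integrableZl measurableT _ (iM n)).
apply: eq_bigr => n _; rewrite mxE RintegralZl// RintegralZl//.
rewrite Rintegral_sum; last exact: iF.
have -> : fine 'E_P[fun w => @f n (fun k => @Y n k w)] =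
    \int[P]_w @f n (fun k => @Y n k w) by rewrite unlock.
congr (_ * _); rewrite (eq_bigr (fun=> \int[P]_w @f n (fun k => @Y n k w))).
  (* The [M n] equal means cancel the normalisation, as [M n] is nonzero. *)
  rewrite sumr_const card_ord -[X in _ * X]mulr_natl mulKf//.
  by rewrite pnatr_eq0 -lt0n hM.
move=> m _.
have indm : mutually_independent Q
    (fun k => @Ys n k m : Omega' -> @T n k).
  apply: (@mutually_independent_reindex _ _ _ _ _ _ _ sampleT sample
    (fun k => sample_index k m)) => // k k' /eqP.
  by rewrite eq_Tagged xpair_eqE eqxx andbT => /eqP.
exact: (@Rintegral_law_unique _ _ (@T n) R _ _ _ _ Q P _ _ (mYs n m) (mY n)
  indm (@indY n) (fun k B mB => @distYs n k m B mB) _ _ (@mf n) (bf n)).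
Qed.

Lemma average_chernoff nu (l t : R) : 0 <= l ->
  (Q [set w | (pairing nu (average w) <=
     pairing nu (mean_vector P (fun n w => @f n (fun k => @Y n k w))) - t)%R] <=
   (expR (l ^+ 2 * sampling_Psi M f nu ^+ 2 / 2 - l * t))%:E)%E.
Proof.
move=> l0.
have := @mcdiarmid_chernoff _ _ _ _ _ _ Q sample measurable_sample indYs
  (weighted_average nu) (weighted_subdiam nu) l t
  (measurable_weighted_average nu) (bounded_differences_weighted_average nu) l0.
rewrite Rintegral_weighted_average sum_weighted_subdiam.
rewrite (_ : l ^+ 2 * (4 * _) / 8 =
    l ^+ 2 * sampling_Psi M f nu ^+ 2 / 2); last by field.
by under eq_set do rewrite -pairing_empirical_average.
Qed.

Lemma measurable_average_event (A : set 'rV[R]_N) : borel_set A ->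
  measurable [set w | A (average w)].
Proof.
apply: measurable_preimage_borel_rV => n.
under eq_fun do rewrite mxE.
apply: measurable_funM => //; apply: measurable_sum => m.
exact: measurable_replica.
Qed.

(** On the event, [nu] paired with the average is at most [pairing nu p], that is, at least [t]
    below its mean when [t > 0]. Chernoff's bound is then optimised over [l]. *)
Lemma average_normal_distance_term (A : set 'rV[R]_N) (p nu : 'rV[R]_N) :
  borel_set A -> A `<=` halfspace p nu ->
  let x := mean_vector P (fun n w => @f n (fun k => @Y n k w)) in
  let z := ((Num.max (pairing nu (x - p)) 0)%:E / (sampling_Psi M f nu)%:E)%E in
  (0 <= z /\ Q [set w | A (average w)] <= expeR (- (z ^+ 2 / 2%:E)))%E.
Proof.
move=> mA Ap x.
set Psi := sampling_Psi M f nu; set t := Num.max _ 0.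
move=> z; set q := Q _.
have Psi0 : 0 <= Psi by rewrite mulr_ge0// sqrtr_ge0.
have mAE := measurable_average_event mA.
have q1 : (q <= 1)%E by exact: probability_le1.
have t0 : 0 <= t by rewrite le_max lexx orbT.
have zge0 : (0 <= z)%E by rewrite mule_ge0 ?inve_ge0 ?lee_fin.
split=> //.
(* Here [z = 0], even if [Psi = 0], and the bound is 1. *)
have [t00|tn0] := eqVneq t 0.
  by rewrite /z t00 mul0e expeR_half_sqrE expr0n/= mul0r oppr0 expR0.
have tp : 0 < t by rewrite lt_neqAle eq_sym tn0.
have tE : t = pairing nu x - pairing nu p.
  have -> : pairing nu x - pairing nu p = pairing nu (x - p).
    rewrite /pairing -sumrB; apply: eq_bigr => n _.
    by rewrite !mxE mulrBr.
  by move: tp; rewrite /t lt_max ltxx orbF => /ltW/max_idPl.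
have chern l : 0 <= l -> (q <= (expR (l ^+ 2 * Psi ^+ 2 / 2 - l * t))%:E)%E.
  move=> l0; apply: le_trans (average_chernoff nu t l0).
  apply: le_measure; rewrite ?inE//.
    rewrite -[X in measurable X]setTI; apply: measurable_fun_le => //.
    rewrite (_ : (fun w => _) = weighted_average nu \o (fun w i => sample i w)).
      exact: (measurableT_comp (measurable_weighted_average nu)
        (measurable_joint measurable_sample)).
    by apply/funext => w; exact: pairing_empirical_average.
  by move=> w /= /Ap; rewrite /halfspace /= tE -/x; lra.
(* If [Psi = 0] then [z = +oo], and the event must be shown to be null. *)
have [Psi00|Psin0] := eqVneq Psi 0.
  rewrite /z Psi00 inver eqxx mulr_infty gtr0_sg// mul1e expe2 mulyy inver.
  rewrite pnatr_eq0/= mulr_infty gtr0_sg ?invr_gt0// mul1e /=.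
  have [r qE r0] : exists2 r, q = r%:E & 0 <= r.
    have q0 : (0 <= q)%E by exact: measure_ge0.
    by case: (q) q0 q1 => [r| |]// r0 _; exists r.
  rewrite qE lee_fin leNgt; apply/negP => rp.
  (* This makes [l * t] exceed [- ln r], so the bound [expR (- (l * t))] falls below [r]. *)
  pose l := (1 + `|ln r|) / t.
  have l0 : 0 <= l by rewrite divr_ge0// addr_ge0.
  have := chern l l0; rewrite qE Psi00 expr0n/= mulr0 mul0r add0r divfK//.
  rewrite lee_fin -[leLHS]lnK ?posrE// ler_expR.
  by have := ler_norm (- ln r); rewrite normrN; lra.
rewrite /z inver (negPf Psin0) -EFinM expeR_half_sqrE.
(* The minimiser of [l ^+ 2 * Psi ^+ 2 / 2 - l * t], with minimum [- (t / Psi) ^+ 2 / 2]. *)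
apply: le_trans (chern (t / Psi ^+ 2) _) _; first by rewrite divr_ge0// sqr_ge0.
rewrite lee_fin ler_expR le_eqVlt; apply/orP; left; apply/eqP.
by field.
Qed.

End Sampling.

Theorem proposition4p4 (R : realType) (N : nat) (K M : 'I_N -> nat)
  (hM : forall n, (1 <= M n)%N)
  (d : forall n : 'I_N, 'I_(K n) -> measure_display)
  (T : forall (n : 'I_N) (k : 'I_(K n)), measurableType (d n k))
  (f : forall n : 'I_N, (forall k : 'I_(K n), T n k) -> R)
  (mf : forall n : 'I_N,
      measurable_fun [set: prod_measurableType (T n)]
        (f n : prod_measurableType (T n) -> R))
  (hD : forall n : 'I_N, (mcdiarmid_diam (f n) < +oo)%E)
  (d1 : measure_display) (Omega : measurableType d1) (P : probability Omega R)
  (Y : forall (n : 'I_N) (k : 'I_(K n)), {RV P >-> T n k})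
  (indY : forall n : 'I_N,
      mutually_independent P (fun k : 'I_(K n) => (Y n k : Omega -> T n k)))
  (d2 : measure_display) (Omega' : measurableType d2)
  (Q : probability Omega' R)
  (Ys : forall (n : 'I_N) (k : 'I_(K n)), 'I_(M n) -> {RV Q >-> T n k})
  (indYs : mutually_independent Q
      (fun i : {n : 'I_N & ('I_(K n) * 'I_(M n))%type} =>
         (Ys (tag i) (tagged i).1 (tagged i).2
            : Omega' -> T (tag i) (tagged i).1)))
  (distYs : forall (n : 'I_N) (k : 'I_(K n)) (m : 'I_(M n)) (B : set (T n k)),
      measurable B -> distribution Q (Ys n k m) B = distribution P (Y n k) B)
  (A : set 'rV[R]_N) (mA : borel_set A) :
  (Q [set w | A (empirical_average f
                   (fun n k m => Ys n k m : Omega' -> T n k) w)]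
     <= expeR (- (normal_dist
                    (fun nu : 'rV[R]_N => (sampling_Psi M f nu)%:E)
                    (mean_vector P
                       (fun (n : 'I_N) (w : Omega) => f n (fun k => Y n k w)))
                    A ^+ 2 / 2%:E)))%E.
Proof.
have mE := measurable_average_event mf Ys mA.
apply: le_expeR_sup_sqr.
- by rewrite measure_ge0; exact: probability_le1.
(* The zero normal gives the whole space as half-space and contributes [0 / 0 = 0], so the supremum
   ranges over a set containing 0. *)
- have p0 y : pairing (0 : 'rV[R]_N) y = 0.
    by rewrite /pairing big1// => n _; rewrite mxE mul0r.
  exists 0, 0; split; first by move=> y _; rewrite /halfspace /= !p0.
  by rewrite p0 maxxx mul0e.
- move=> z [p [nu [Ap ->]]].
  exact: average_normal_distance_term.
Qed.
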